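(* Let $k$ be a rational number with $k\not\equiv0,4,5,11\pmod{12}$. For integers $r\ne1$ and $s\ne1$, the matrix $N(r,s)=\rho((T^rST^sS)^2)=(\rho(T)^r\rho(S)\rho(T)^s\rho(S))^2$ is given by $$N(r,s)=-Z_rZ_sE+\frac12K_{r,s}\begin{pmatrix}\frac12+\frac18\big(2(Z_s-1)+W_s\big)(2+W_r)& iG_{12}\big(2(Z_s-Z_r)+(Z_r-1)W_s\big)\\ iG_{21}Z_rW_s&\frac14Z_r(2-W_s)\end{pmatrix},$$ where $K_{r,s}=W_rW_s+4(Z_r+Z_s)$.
   Context: For rational $k$ and integer $j$, ''$k\equiv j\pmod{12}$'' means $k-j\in12\mathbb{Z}$. $E$ is the $2\times2$ identity matrix. Put $\theta=\frac{1+k}{6}\pi$, $C=\csc\theta=1/\sin\theta$, and for $l\in\mathbb{Z}$, $Z_l=e^{2li\theta}$, $W_l=(Z_l-1)C$. Put $$G_{12}=\frac{\sqrt\pi\,\Gamma(\frac{1+k}{6})}{4\Gamma(\frac{2+k}{12})\Gamma(\frac{6+k}{12})},\qquad G_{21}=\frac{\sqrt\pi\,\Gamma(\frac{5-k}{6})}{2\Gamma(\frac{6-k}{12})\Gamma(\frac{10-k}{12})},$$ where $1/\Gamma$ is the entire reciprocal Gamma function, and $$\rho(T)=\begin{pmatrix}1&4iG_{12}(1-Z_1)\\0&Z_1\end{pmatrix},\qquad\rho(S)=\begin{pmatrix}-1&0\\-4iG_{21}&1\end{pmatrix}.$$ For a word in $T,S$, $\rho$ of the word is the corresponding product of these matrices,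 in the same order. *)

(* Defs.v *)
From HB Require Import structures.
From mathcomp Require Import all_boot all_order all_algebra.
From mathcomp Require Import complex.
From mathcomp Require Import all_classical all_reals all_analysis.

Set Implicit Arguments.
Unset Strict Implicit.
Unset Printing Implicit Defensive.

Import Order.TTheory GRing.Theory Num.Theory.
Import numFieldNormedType.Exports.

Local Open Scope complex_scope.
Local Open Scope ring_scope.

Definition congr12 (k : rat) (j : int) : Prop :=
  exists m : int, k - j%:~R = (12 * m)%:~R.

(* Euler's limit formula
     1/Gamma(x) = lim_n x (x + 1) ... (x + n) / (n! n^x),
   valid at every x: this is the entire function 1/Gamma on the real axis,
   vanishing exactly at x = 0, -1, -2, ... *)
Definition rGamma (R : realType) (x : R) : R :=
  limn (fun n : nat =>
    (\prod_(i < n.+1) (x + i%:R)) / (n`!%:R * (n%:R `^ x)) : R).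

(* Meaningful away from the poles 0, -1, -2, ... *)
Definition Gamma (R : realType) (x : R) : R := (rGamma x)^-1.

Definition expc (R : realType) (z : R[i]) : R[i] :=
  (expR (complex.Re z))%:C * (cos (complex.Im z) +i* sin (complex.Im z)).

Definition mx2 (A : Type) (a b c d : A) : 'M[A]_2 :=
  \matrix_(i < 2, j < 2)
    if i == 0 :> nat then (if j == 0 :> nat then a else b)
    else (if j == 0 :> nat then c else d).

Inductive gen := genT | genS.

(* A word in T and S is a list of syllables g^n, read from left to right. *)
Definition word := seq (gen * int).

Definition TrSTsS (r s : int) : word :=
  [:: (genT, r); (genS, 1); (genT, s); (genS, 1)].

Section Rho.
Variables (R : realType) (k : rat).

Definition theta : R := (1 + ratr k) / 6 * pi.

Definition cosec : R := (sin theta)^-1.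

Definition Z (l : int) : R[i] := expc (2 * l%:~R * 'i * theta%:C).

Definition W (l : int) : R[i] := (Z l - 1) * cosec%:C.

Definition G12 : R :=
  Num.sqrt pi * Gamma ((1 + ratr k) / 6) / 4
  * rGamma ((2 + ratr k) / 12) * rGamma ((6 + ratr k) / 12).

Definition G21 : R :=
  Num.sqrt pi * Gamma ((5 - ratr k) / 6) / 2
  * rGamma ((6 - ratr k) / 12) * rGamma ((10 - ratr k) / 12).

Definition rhoT : 'M[R[i]]_2 := mx2 1 (4 * 'i * G12%:C * (1 - Z 1)) 0 (Z 1).

Definition rhoS : 'M[R[i]]_2 := mx2 (-1) 0 (- (4 * 'i * G21%:C)) 1.

Definition rho_gen (g : gen) : 'M[R[i]]_2 :=
  match g with genT => rhoT | genS => rhoS end.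

Definition rho (w : word) : 'M[R[i]]_2 := \prod_(x <- w) rho_gen x.1 ^ x.2.

Definition N (r s : int) : 'M[R[i]]_2 := rho (TrSTsS r s ++ TrSTsS r s).

Definition K (r s : int) : R[i] := W r * W s + 4 * (Z r + Z s).

End Rho.

(* Main.v *)
(* The matrix M = rho(T)^r rho(S) rho(T)^s rho(S) satisfies
   M^2 = tr(M) M - det(M) E by Cayley-Hamilton, and its entries depend on k only
   through the Z_l, G12, G21 and the product G12 G21.  Euler's reflection formula
   evaluates this product as 1/16 + C/32, the three pairs of Gamma arguments each
   having sum 1; this gives tr(M) = K_{r,s}/4 and the formula.

   The reflection formula is equivalent to Euler's product for the sine, which
   is obtained from the moments of cos(2xt) cos(t)^(2m) over [0, pi/2]: the
   recurrence between consecutive moments produces the factors 1 - x^2/m^2, and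
   the moments for x and for 0 become asymptotically equal. *)
Require Import Defs.
From mathcomp Require Import all_boot all_order all_algebra.
From mathcomp Require Import complex.
From mathcomp Require Import all_classical all_reals all_analysis.
From mathcomp Require Import ring lra.
Import Order.TTheory GRing.Theory Num.Theory.
Import numFieldNormedType.Exports.
Local Open Scope classical_set_scope.
Local Open Scope complex_scope.
Local Open Scope ring_scope.

(** * Convergence of Euler's limit for 1/Gamma at every real argument *)

(** The sequence under the limit in [rGamma]. Its term at n = 0 divides by 0^x and is a default
    value, so statements about terms ask for 0 < n. *)
Definition rGamma_seq (R : realType) (x : R) (n : nat) : R :=
  (\prod_(i < n.+1) (x + i%:R)) / (n`!%:R * (n%:R `^ x)).

(** Young's inequality for the numbers a^x and 1 with the conjugate exponents 1/x and 1/(1 - x); the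
    endpoints x = 0 and x = 1 are separate. *)
Lemma powR_le_bernoulli (R : realType) (a x : R) :
  0 < a -> 0 <= x <= 1 -> a `^ x <= 1 + x * (a - 1).
Proof.
move=> a0 /andP[x0 x1].
have [->|xn0] := eqVneq x 0; first by rewrite powRr0 mul0r addr0.
have [->|xn1] := eqVneq x 1; first by rewrite powRr1 ?(ltW a0)//; lra.
have xp : 0 < x by rewrite lt_neqAle eq_sym xn0.
have xp1 : 0 < 1 - x by rewrite subr_gt0 lt_neqAle xn1.
have := @conjugate_powR R (a `^ x) 1 x^-1 (1 - x)^-1 (powR_ge0 _ _) ler01.
rewrite !invr_gt0 !invrK mulr1 powR1 -powRrM divff// powRr1 ?(ltW a0)//.
move=> /(_ xp xp1) h; have {}h := h (subrKC _ _); move: h => /=; rewrite mul1r; lra.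
Qed.

Lemma rGamma_seqS (R : realType) (x : R) (n : nat) : (0 < n)%N ->
  rGamma_seq R x n.+1 =
  rGamma_seq R x n * ((1 + x / n.+1%:R) * (n%:R / n.+1%:R) `^ x).
Proof.
move=> n0; rewrite /rGamma_seq big_ord_recr /= factS natrM.
have nR : 0 < n%:R :> R by rewrite ltr0n.
have nS : 0 < n.+1%:R :> R by rewrite ltr0n.
have -> : (n%:R / n.+1%:R) `^ x = n%:R `^ x / n.+1%:R `^ x :> R.
  apply: (mulIf (x := n.+1%:R `^ x)); first by rewrite gt_eqF ?powR_gt0.
  rewrite -powRM ?divr_ge0 ?ler0n// !divfK ?gt_eqF ?powR_gt0//.
have fn0 : n`!%:R != 0 :> R by rewrite pnatr_eq0 -lt0n fact_gt0.
have pn0 : n%:R `^ x != 0 by rewrite gt_eqF ?powR_gt0.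
have pS0 : n.+1%:R `^ x != 0 by rewrite gt_eqF ?powR_gt0.
by field; rewrite fn0 pn0 pS0 nat1r gt_eqF.
Qed.

(** Finite form of 1/Gamma(x) = x/Gamma(x + 1); it transports convergence between x and x + 1. *)
Lemma rGamma_seq_shift (R : realType) (x : R) (n : nat) : (0 < n)%N ->
  rGamma_seq R x n * (x + n.+1%:R) = x * rGamma_seq R (x + 1) n * n%:R.
Proof.
move=> n0; rewrite /rGamma_seq.
have nR : 0 < n%:R :> R by rewrite ltr0n.
rewrite powRD ?(gt_eqF nR) ?implybT// powRr1 ?(ltW nR)//.
have pr : (\prod_(i < n.+1) (x + i%:R)) * (x + n.+1%:R) =
    x * \prod_(i < n.+1) (x + 1 + i%:R).
  transitivity (\prod_(i < n.+2) (x + i%:R)); first by rewrite [RHS]big_ord_recr.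
  rewrite big_ord_recl /= addr0; congr (_ * _).
  by apply: eq_bigr => i _; rewrite /bump /= add1n -natr1; ring.
have fn0 : n`!%:R != 0 :> R by rewrite pnatr_eq0 -lt0n fact_gt0.
have pn0 : n%:R `^ x != 0 by rewrite gt_eqF ?powR_gt0.
transitivity ((\prod_(i < n.+1) (x + i%:R) * (x + n.+1%:R)) / (n`!%:R * n%:R `^ x)); first by ring.
rewrite pr; field; rewrite ?fn0 ?pn0 ?gt_eqF//.
Qed.

Lemma cvg_ratio1 (R : realType) (c d : R) :
  (c + n%:R) / (d + n%:R) @[n --> \oo] --> (1 : R).
Proof.
have dy : d + n%:R @[n --> \oo] --> +oo.
  apply/cvgryPge => A; near=> n.
  rewrite -lerBlDl; near: n; exact: nbhs_infty_ger.
have h : (1 : R) + (c - d) * (d + n%:R)^-1 @[n --> \oo] --> (1 : R).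
  have hz : (c - d) * (d + n%:R)^-1 @[n --> \oo] --> (c - d) * 0.
    apply: cvgM; first exact: cvg_cst.
    apply/gtr0_cvgV0 => //.
    by near=> n; near: n; exact: cvgry_gt.
  have := cvgD (cvg_cst (1 : R)) hz; rewrite mulr0 addr0; exact.
apply: cvg_trans h; apply: near_eq_cvg; near=> n.
have dn : d + n%:R != 0 by rewrite gt_eqF//; near: n; exact: cvgry_gt.
by field.
Unshelve. all: by end_near. Qed.

(** From n = 1 on the terms are nonnegative and decrease: by Bernoulli the quotient of consecutive
    terms, with N the new index, is at most (1 + x/N)(1 - x/N) <= 1. *)
Lemma rGamma_seq_cvg01 (R : realType) (x : R) : 0 <= x <= 1 ->
  cvgn (rGamma_seq R x).
Proof.
move=> /andP[x0 x1].
have ge0 n : 0 <= rGamma_seq R x n.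
  rewrite divr_ge0 ?mulr_ge0 ?powR_ge0 ?ler0n// prodr_ge0// => i _.
  by rewrite addr_ge0 ?ler0n.
have : cvgn [sequence rGamma_seq R x n.+1]_n.
  apply: nonincreasing_is_cvgn; last by exists 0 => _ [n _ <-] /=.
  apply/nonincreasing_seqP => n /=.
  rewrite [leLHS]rGamma_seqS// ler_piMr//.
  set N1 : R := n.+2%:R.
  have N1p : 0 < N1 by rewrite ltr0n.
  have eN : n.+1%:R / N1 = 1 - 1 / N1.
    have Nn0 : N1 != 0 by rewrite gt_eqF.
    by apply: (mulIf Nn0); rewrite mulrBl !divfK// mul1r /N1 -[n.+2%:R]natr1 addrK.
  have apos : 0 < n.+1%:R / N1 by rewrite divr_gt0 ?ltr0n.
  have := @powR_le_bernoulli R _ x apos; rewrite x0 x1 => /(_ isT).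
  rewrite eN => h.
  have y0 : 0 <= x / N1 by rewrite divr_ge0// ltW.
  have h1 : (1 + x / N1) * (1 - x / N1) <= 1 by rewrite mulrC -subr_sqr expr1n gerBl ?sqr_ge0.
  apply: le_trans h1; apply: ler_wpM2l; first by rewrite addr_ge0.
  have e : 1 - 1 / N1 - 1 = - (1 / N1) by ring.
  by apply: le_trans h _; rewrite e mulrN mulrA mulr1.
by move=> /cvg_ex[l]; rewrite cvg_shiftS => h; apply: cvgP h.
Qed.

(** Integer steps up or down reach every x from a point of the unit interval. *)
Lemma rGamma_seq_cvg (R : realType) (x : R) : cvgn (rGamma_seq R x).
Proof.
have up (y : R) : y != 0 -> cvgn (rGamma_seq R y) -> cvgn (rGamma_seq R (y + 1)).
  move=> y0 cy.
  have : cvgn (fun n => y^-1 * (rGamma_seq R y n * ((y + 1 + n%:R) / (0 + n%:R)))).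
    apply: is_cvgM; first exact: is_cvg_cst.
    by apply: is_cvgM => //; apply: cvgP; apply: cvg_ratio1.
  move=> /cvg_ex[l hl]; apply: (cvgP l); apply: cvg_trans hl.
  apply: near_eq_cvg; near=> n.
  have n0 : (0 < n)%N by near: n; exists 1%N.
  have nR : n%:R != 0 :> R by rewrite pnatr_eq0 -lt0n.
  have := rGamma_seq_shift R y n n0; rewrite -natr1 => e.
  rewrite add0r mulrA -(addrA y) (addrC 1) mulrA -(mulrA y^-1) e; field.
  by rewrite nR.
have down (y : R) : cvgn (rGamma_seq R (y + 1)) -> cvgn (rGamma_seq R y).
  move=> cy.
  have : cvgn (fun n => y * (rGamma_seq R (y + 1) n * ((0 + n%:R) / (y + 1 + n%:R)))).
    apply: is_cvgM; first exact: is_cvg_cst.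
    by apply: is_cvgM => //; apply: cvgP; apply: cvg_ratio1.
  move=> /cvg_ex[l hl]; apply: (cvgP l); apply: cvg_trans hl.
  apply: near_eq_cvg; near=> n.
  have n0 : (0 < n)%N by near: n; exists 1%N.
  have yn : y + 1 + n%:R != 0.
    rewrite gt_eqF// -ltrBlDl; near: n; exact: nbhs_infty_gtr.
  have := rGamma_seq_shift R y n n0; rewrite -natr1 (addrC n%:R) addrA => e.
  apply: (mulIf yn); rewrite e; field.
  by rewrite yn.
have cvgB (y : R) (n : nat) : cvgn (rGamma_seq R y) -> cvgn (rGamma_seq R (y - n%:R)).
  elim: n => [|n IH] in y *; first by rewrite subr0.
  move=> /IH cy; apply: down.
  by rewrite -natr1 opprD addrA subrK.
have cvgD (y : R) (n : nat) : 0 < y -> cvgn (rGamma_seq R y) ->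
    cvgn (rGamma_seq R (y + n%:R)).
  move=> y0 cy; elim: n => [|n IH]; first by rewrite addr0.
  by rewrite -natr1 addrA; apply: up => //; rewrite gt_eqF// ltr_wpDr.
have /andP[] := ceil_itv x; rewrite intrB => ltx lex.
(* The ceiling puts y in (0, 1], not [0, 1), so the upward steps never divide by 0. *)
pose y := x - ((Num.ceil x)%:~R - 1).
have y0 : 0 < y by rewrite /y; lra.
have cy : cvgn (rGamma_seq R y) by apply: rGamma_seq_cvg01; rewrite /y; lra.
have -> : x = y + (Num.ceil x - 1)%:~R by rewrite /y intrB; ring.
case: (Num.ceil x - 1) => n; first exact: cvgD.
by rewrite NegzE mulrNz; exact: cvgB.
Unshelve. all: by end_near. Qed.

(** * Elementary inequalities for sine and cosine *)

(** By the mean value theorem f(t) = f'(c) t; the three inequalities below are instances. *)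
Lemma ge0_of_derive_ge0 (R : realType) (f df : R -> R) (b : R) :
  (forall t : R, is_derive t (1 : R) f (df t)) ->
  (forall t, 0 <= t <= b -> 0 <= df t) -> f 0 = 0 ->
  forall t, 0 <= t <= b -> 0 <= f t.
Proof.
move=> fdf df0 f0 t /andP[t0 tb].
have cf : {within `[0, t], continuous f}.
  by apply: derivable_within_continuous => u _; apply: ex_derive.
have [c] := MVT_segment t0 (fun u _ => fdf u) cf.
rewrite in_itv /= f0 !subr0 => /andP[c0 ct] ->.
by rewrite mulr_ge0// df0// c0 (le_trans ct).
Qed.

Lemma sin_le_id (R : realType) (u : R) : 0 <= u -> sin u <= u.
Proof.
move=> u0; rewrite -subr_ge0.
apply: (@ge0_of_derive_ge0 R (fun u => u - sin u) (fun u => 1 - cos u) u) => //.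
- by rewrite sin0 subr0.
- by rewrite u0 lexx.
Qed.

Lemma one_sub_cos_le (R : realType) (u : R) : 1 - cos u <= u ^+ 2 / 2.
Proof.
wlog u0 : u / 0 <= u => [h|].
  by case: (leP 0 u) => [/h//|u0]; rewrite -cosN -sqrrN h// oppr_ge0 ltW.
rewrite -subr_ge0.
apply: (@ge0_of_derive_ge0 R (fun u => u ^+ 2 / 2 - (1 - cos u)) (fun u => u - sin u) u) => //.
- move=> t.
  have -> : (fun u : R => u ^+ 2 / 2 - (1 - cos u)) = (2^-1 \*: (id ^+ 2 : R -> R)) - (cst 1 - cos).
    by apply/funext => v; rewrite !fctE /= /GRing.scale /= mulrC.
  by apply: is_derive_eq; rewrite /GRing.scale /=; field.
- by move=> t /andP[t0 _]; rewrite subr_ge0 sin_le_id.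
- by rewrite cos0 expr0n /= mul0r !subrr.
- by rewrite u0 lexx.
Qed.

Lemma id_mul_cos_le_sin (R : realType) (t : R) : 0 <= t <= pi / 2 -> t * cos t <= sin t.
Proof.
have p0 := pi_gt0 R; move=> tI; rewrite -subr_ge0.
apply: (@ge0_of_derive_ge0 R (fun u => sin u - u * cos u) (fun u => u * sin u) (pi / 2)) => //.
- move=> v.
  have -> : (fun u : R => sin u - u * cos u) = (sin - id * cos) by apply/funext.
  apply: is_derive_eq; rewrite /GRing.scale /=; ring.
- move=> u /andP[u0 u1]; rewrite mulr_ge0// sin_ge0_pi// u0 /=; lra.
- by rewrite sin0 mul0r subrr.
Qed.

(** * Integration over [0, pi/2] and the moments of the cosine *)

Definition int_pihalf (R : realType) (f : R -> R) : R :=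
  \int[lebesgue_measure]_(t in `[0, (pi / 2 : R)]) f t.

Lemma integrable_pihalf (R : realType) (f : R -> R) : continuous f ->
  (@lebesgue_measure R).-integrable `[0, (pi / 2 : R)] (EFin \o f).
Proof.
move=> cf; apply: continuous_compact_integrable; first exact: segment_compact.
exact: continuous_subspaceT.
Qed.

Lemma int_pihalf_FTC (R : realType) (F f : R -> R) :
  (forall t : R, is_derive t (1 : R) F (f t)) -> continuous f ->
  int_pihalf R f = F (pi / 2) - F 0.
Proof.
move=> dF cf; have p0 := pi_gt0 R.
have cF : continuous F.
  move=> t; apply: differentiable_continuous; apply/derivable1_diffP.
  by apply: ex_derive.
rewrite /int_pihalf /Rintegral (@continuous_FTC2 R f F) //.
- by rewrite divr_gt0.
- exact: continuous_subspaceT.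
- split; first by move=> t _; apply: ex_derive.
  + by apply: cvg_at_right_filter; exact: cF.
  + by apply: cvg_at_left_filter; exact: cF.
- by move=> t _; rewrite derive1E; apply: derive_val.
Qed.

Lemma int_pihalfD (R : realType) (a b : R) (f g : R -> R) :
  continuous f -> continuous g ->
  int_pihalf R (fun t => a * f t + b * g t) = a * int_pihalf R f + b * int_pihalf R g.
Proof.
move=> cf cg.
have cZ (c : R) h : continuous h -> continuous (fun t : R => c * h t : R).
  by move=> ch t; apply: (@cvgM _ _ _ _ (cst c) h); [exact: cvg_cst | exact: ch].
rewrite /int_pihalf RintegralD //.
- by rewrite !RintegralZl //; exact: integrable_pihalf.
- by apply: integrable_pihalf; exact: cZ.
- by apply: integrable_pihalf; exact: cZ.
Qed.

Lemma le_int_pihalf (R : realType) (f g : R -> R) :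
  continuous f -> continuous g ->
  (forall t, 0 <= t <= pi / 2 -> f t <= g t) ->
  int_pihalf R f <= int_pihalf R g.
Proof.
move=> cf cg fg; apply: le_Rintegral => //.
- exact: integrable_pihalf.
- exact: integrable_pihalf.
Qed.

(** The sine product uses even n = 2m, with y = 2x and y = 0. *)
Definition cos_moment (R : realType) (n : nat) (y : R) : R :=
  int_pihalf R (fun t => cos (y * t) * cos t ^+ n).

Lemma is_derive_scale (R : realType) (f : R -> R) (df y t : R) :
  is_derive (y * t) (1 : R) f df ->
  is_derive t (1 : R) (fun t => f (y * t)) (y * df).
Proof.
move=> h.
have -> : (fun t => f (y * t)) = f \o (y \*: id) by apply/funext.
by apply: is_derive_eq; rewrite /GRing.scale /=; ring.
Qed.

Lemma is_derive_cosX (R : realType) (n : nat) (t : R) :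
  is_derive t (1 : R) (fun t => cos t ^+ n.+1) (- (n.+1%:R * cos t ^+ n * sin t)).
Proof.
have -> : (fun t : R => cos t ^+ n.+1) = cos ^+ n.+1.
  by apply/funext => u; rewrite !fctE.
by apply: is_derive_eq; rewrite /GRing.scale /=; ring.
Qed.

Lemma continuous_lincomb (R : realType) (a b : R) (f g : R -> R) :
  continuous f -> continuous g -> continuous (fun t => a * f t + b * g t).
Proof.
move=> cf cg t.
by apply: cvgD; apply: cvgM; [exact: cvg_cst | exact: cf | exact: cvg_cst | exact: cg].
Qed.

Lemma continuous_cos_moment (R : realType) (n : nat) (y : R) :
  continuous (fun t : R => cos (y * t) * cos t ^+ n : R).
Proof.
have cX : continuous (fun t : R => cos t ^+ n : R).
  move=> t; apply: (@continuous_comp _ _ _ cos (fun u : R => u ^+ n)).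
    exact: continuous_cos.
  exact: exprn_continuous.
move=> t; apply: (@cvgM _ _ _ _ (fun t : R => cos (y * t)) (fun t => cos t ^+ n)); last exact: cX.
apply: (@continuous_comp _ _ _ (fun t : R => y * t) cos); last exact: continuous_cos.
exact: mulrl_continuous.
Qed.

(* Integrate the derivative of
   (n+2) cos(y t) cos(t)^(n+1) sin(t) - y sin(y t) cos(t)^(n+2). *)
Lemma cos_moment_rec (R : realType) (n : nat) (y : R) :
  (n.+2%:R ^+ 2 - y ^+ 2) * cos_moment R n.+2 y =
  n.+2%:R * n.+1%:R * cos_moment R n y.
Proof.
pose F (t : R) := n.+2%:R * (cos (y * t) * (cos t ^+ n.+1 * sin t)) -
  y * (sin (y * t) * cos t ^+ n.+2).
pose f (t : R) := (n.+2%:R ^+ 2 - y ^+ 2) * (cos (y * t) * cos t ^+ n.+2) +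
  (- (n.+2%:R * n.+1%:R)) * (cos (y * t) * cos t ^+ n).
have dF (t : R) : is_derive t (1 : R) F (f t).
  have d1 := is_derive_scale R cos _ y t (is_derive_cos (y * t)).
  have d2 := is_derive_scale R sin _ y t (is_derive_sin (y * t)).
  have d3 := is_derive_cosX R n t.
  have d4 := is_derive_cosX R n.+1 t.
  have -> : F = n.+2%:R \*: ((fun t => cos (y * t)) * ((fun t => cos t ^+ n.+1) * sin)) -
    y \*: ((fun t => sin (y * t)) * (fun t => cos t ^+ n.+2)).
    by apply/funext.
  apply: is_derive_eq; rewrite /f !fctE /GRing.scale /=.
  (* The two terms with sin(y t) cancel; replacing sin^2 by 1 - cos^2 then gives f. *)
  transitivity (n.+2%:R * cos (y * t) * (cos t ^+ n.+2 - n.+1%:R * cos t ^+ n * sin t ^+ 2)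
     - y ^+ 2 * cos (y * t) * cos t ^+ n.+2).
    by rewrite !exprS; ring.
  by rewrite sin2cos2 -!natr1 !exprS; ring.
have cf : continuous f by apply: continuous_lincomb; exact: continuous_cos_moment.
have := int_pihalf_FTC R F f dF cf.
rewrite int_pihalfD; [|exact: continuous_cos_moment..].
(* F vanishes at both ends, since cos(pi/2) = 0 and sin(0) = 0, so the integral of f is 0. *)
rewrite /F cos_pihalf sin0 !mulr0 sin0 !expr0n /= !mul0r !mulr0 !subr0.
by move/eqP; rewrite mulNr subr_eq0 => /eqP.
Qed.

(* From 1 - cos(y t) <= (y t)^2 / 2 and t cos(t) <= sin(t). *)
Lemma cos_moment_dist (R : realType) (n : nat) (y : R) :
  0 <= cos_moment R n.+2 0 - cos_moment R n.+2 y <=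
  y ^+ 2 / 2 * (cos_moment R n 0 - cos_moment R n.+2 0).
Proof.
have cM := continuous_cos_moment R.
have cosp (t : R) : 0 <= t <= pi / 2 -> 0 <= cos t.
  by move=> h; rewrite cos_ge0_pihalf//; have := pi_gt0 R; lra.
have E (m l : nat) (z w a : R) : a * (cos_moment R m z - cos_moment R l w) =
    int_pihalf R (fun t => a * (cos (z * t) * cos t ^+ m) + (- a) * (cos (w * t) * cos t ^+ l)).
  by rewrite int_pihalfD// mulrBr mulNr.
apply/andP; split.
  have := le_int_pihalf R _ _ (cM n.+2 y) (cM n.+2 0).
  rewrite subr_ge0; apply => t tI.
  by rewrite ler_wpM2r ?exprn_ge0 ?cosp// mul0r cos0 cos_le1.
rewrite -[leLHS]mul1r !E; apply: le_int_pihalf => [||t tI].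
- exact: continuous_lincomb.
- exact: continuous_lincomb.
have c0 := cosp t tI.
have h1 := one_sub_cos_le R (y * t).
have tc : (t * cos t) ^+ 2 <= sin t ^+ 2.
  move/andP: (tI) => [t0 _].
  have := id_mul_cos_le_sin R t tI.
  have : 0 <= t * cos t by rewrite mulr_ge0.
  move: (t * cos t) (sin t) => u v u0 uv; nra.
rewrite !mul0r cos0 !mul1r.
have P0 : 0 <= cos t ^+ n by rewrite exprn_ge0.
have k0 : 0 <= y ^+ 2 / 2 by rewrite divr_ge0 ?sqr_ge0.
(* Two of the n + 2 cosine factors absorb t^2: (t cos t)^2 <= sin^2 t = 1 - cos^2 t, which turns the
   bound into a difference of moments. *)
apply: (@le_trans _ _ ((y * t) ^+ 2 / 2 * (cos t ^+ 2 * cos t ^+ n))).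
  have -> : cos t ^+ n.+2 + -1 * (cos (y * t) * cos t ^+ n.+2) =
    (1 - cos (y * t)) * (cos t ^+ 2 * cos t ^+ n) by rewrite -exprD; ring.
  by rewrite ler_wpM2r// mulr_ge0 ?sqr_ge0.
have -> : (y * t) ^+ 2 / 2 * (cos t ^+ 2 * cos t ^+ n) =
    y ^+ 2 / 2 * ((t * cos t) ^+ 2 * cos t ^+ n) by field.
have -> : y ^+ 2 / 2 * cos t ^+ n + - (y ^+ 2 / 2) * cos t ^+ n.+2 =
    y ^+ 2 / 2 * (sin t ^+ 2 * cos t ^+ n).
  by rewrite sin2cos2 !exprS; ring.
by rewrite ler_wpM2l// ler_wpM2r.
Qed.

Lemma cos_moment0 (R : realType) : cos_moment R 0 0 = pi / 2.
Proof.
have d (t : R) : is_derive t (1 : R) id (cos (0 * t) * cos t ^+ 0).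
  by rewrite mul0r cos0 mul1r expr0; exact: is_derive_id.
have := int_pihalf_FTC R _ _ d (continuous_cos_moment R 0 0).
by rewrite /= subr0.
Qed.

Lemma mul_cos_moment_0 (R : realType) (y : R) :
  y * cos_moment R 0 y = sin (y * (pi / 2)).
Proof.
(* The zero summand only gives the derivative the shape of a linear combination, as in
   [int_pihalfD]. *)
have dF (t : R) : is_derive t (1 : R) (fun t => sin (y * t)) (y * (cos (y * t) * cos t ^+ 0) + 0 * (cos (y * t) * cos t ^+ 0)).
  by rewrite mul0r addr0 expr0 mulr1; exact: is_derive_scale.
have cM := continuous_cos_moment R 0 y.
have := int_pihalf_FTC R _ _ dF (continuous_lincomb R _ _ _ _ cM cM).
by rewrite int_pihalfD// mul0r addr0 mulr0 sin0 subr0.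
Qed.

Lemma cos_moment_even_gt0 (R : realType) (m : nat) : 0 < cos_moment R m.*2 0.
Proof.
elim: m => [|m IH]; first by rewrite cos_moment0 divr_gt0 ?pi_gt0.
have := cos_moment_rec R m.*2 0; rewrite expr0n subr0 doubleS => h.
by rewrite -(@pmulr_rgt0 _ (m.*2.+2%:R ^+ 2)) ?exprn_gt0 ?ltr0n// h !mulr_gt0 ?ltr0n.
Qed.

(** * Euler's product for the sine *)

(** The factor that completes the m-th partial product to sin(pi x)/pi, as [sine_product_ratio]
    shows. *)
Definition cos_moment_ratio (R : realType) (x : R) (m : nat) : R :=
  cos_moment R m.*2 (2 * x) / cos_moment R m.*2 0.

(** The ratio at m + 1 is squeezed between 1 - 2x^2/(m + 1) and 1 by [cos_moment_dist] at y = 2x. *)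
Lemma cos_moment_ratio_cvg (R : realType) (x : R) :
  cos_moment_ratio R x m @[m --> \oo] --> (1 : R).
Proof.
rewrite -cvg_shiftS.
have h0 : (2 * x ^+ 2) * (@harmonic R) n @[n --> \oo] --> (0 : R).
  rewrite -[X in _ --> X](mulr0 (2 * x ^+ 2)).
  by apply: cvgM; [exact: cvg_cst | exact: cvg_harmonic].
have h1 : 1 - (2 * x ^+ 2) * (@harmonic R) n @[n --> \oo] --> (1 : R).
  have := cvgB (cvg_cst (1 : R)) h0; rewrite subr0; exact.
apply: (@squeeze_cvgr _ _ _ _ (fun n => 1 - 2 * x ^+ 2 * (@harmonic R) n) (cst 1)) => //; last exact: cvg_cst.
apply: nearW => m /=.
rewrite /cos_moment_ratio doubleS.
have p0 := cos_moment_even_gt0 R m.+1; rewrite doubleS in p0.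
have /andP[d0 d1] := cos_moment_dist R m.*2 (2 * x).
have rec := cos_moment_rec R m.*2 0; rewrite expr0n subr0 in rec.
rewrite ler_pdivlMr// ler_pdivrMr// mul1r; apply/andP; split; last lra.
rewrite mulrBl mul1r lerBlDr -lerBlDl; apply: le_trans d1 _.
(* The recurrence at y = 0 makes the gap between consecutive moments small relative to the moment
   itself. *)
have e : cos_moment R m.*2 0 - cos_moment R m.*2.+2 0 = cos_moment R m.*2.+2 0 / m.*2.+1%:R.
  have n0 : m.*2.+1%:R != 0 :> R by rewrite pnatr_eq0.
  have n2 : m.*2.+2%:R != 0 :> R by rewrite pnatr_eq0.
  apply: (mulfI n2); apply: (mulIf n0).
  transitivity (m.*2.+2%:R * m.*2.+1%:R * cos_moment R m.*2 0 -
    m.*2.+2%:R * m.*2.+1%:R * cos_moment R m.*2.+2 0); first by ring.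
  rewrite -rec -[m.*2.+2%:R]natr1; move: (m.*2.+1%:R : R) n0 => v v0.
  by field.
rewrite e [_ / m.*2.+1%:R]mulrC /harmonic.
have -> : (2 * x) ^+ 2 / 2 = 2 * x ^+ 2 by field.
have x20 : 0 <= 2 * x ^+ 2 by rewrite mulr_ge0 ?sqr_ge0.
rewrite mulrA ler_wpM2r ?(ltW p0)// ler_wpM2l//.
by rewrite lef_pV2 ?posrE ?ltr0n// ler_nat ltnS -addnn leq_addr.
Qed.

(** The left side does not depend on m: dividing the recurrence for y = 2x by that for y = 0 shows
    that the ratio at m is 1 - x^2/(m + 1)^2 times the ratio at m + 1. The value at m = 0 is an
    explicit integral. *)
Lemma sine_product_ratio (R : realType) (x : R) (m : nat) :
  x * (\prod_(i < m) (1 - x ^+ 2 / i.+1%:R ^+ 2)) * cos_moment_ratio R x m =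
  sin (pi * x) / pi.
Proof.
have pi0 : 0 < pi :> R := pi_gt0 R.
elim: m => [|m <-].
  rewrite big_ord0 mulr1 /cos_moment_ratio double0 cos_moment0.
  have := mul_cos_moment_0 R (2 * x).
  have -> : 2 * x * (pi / 2) = pi * x by field.
  move=> <-; move: (pi : R) pi0 => p p0; field; by rewrite gt_eqF.
rewrite big_ord_recr /= -!mulrA; congr (x * (_ * _)).
have p0 := cos_moment_even_gt0 R m.
have p1 := cos_moment_even_gt0 R m.+1.
rewrite /cos_moment_ratio; rewrite doubleS in p1 *.
have r0 := cos_moment_rec R m.*2 0; rewrite expr0n subr0 in r0.
have r1 := cos_moment_rec R m.*2 (2 * x).
have mE : m.*2.+2%:R = 2 * m.+1%:R :> R by rewrite -doubleS -muln2 natrM mulrC.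
have mp : 0 < m.+1%:R :> R by rewrite ltr0n.
have mq : 0 < m.*2.+1%:R :> R by rewrite ltr0n.
rewrite mE in r0 r1.
move: r0 r1 p0 p1 mp mq; move: (cos_moment R m.*2 0) (cos_moment R m.*2.+2 0) => a b.
move: (cos_moment R m.*2 _) (cos_moment R m.*2.+2 _) => c d.
move: (m.+1%:R : R) (m.*2.+1%:R : R) => u v r0 r1 a0 b0 u0 v0.
have -> : a = 2 * u * b / v.
  apply: (mulfI (x := 2 * u * v)); first by rewrite gt_eqF// !mulr_gt0.
  rewrite -r0; field; by rewrite gt_eqF.
have -> : c = ((2 * u) ^+ 2 - (2 * x) ^+ 2) * d / (2 * u * v).
  apply: (mulfI (x := 2 * u * v)); first by rewrite gt_eqF// !mulr_gt0.
  rewrite -r1; field; by rewrite !gt_eqF.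
field; by rewrite !gt_eqF.
Qed.

Lemma sine_product (R : realType) (x : R) :
  x * (\prod_(i < n) (1 - x ^+ 2 / i.+1%:R ^+ 2)) @[n --> \oo] -->
  sin (pi * x) / pi.
Proof.
have q1 := cos_moment_ratio_cvg R x.
have h : sin (pi * x) / pi * (cos_moment_ratio R x n)^-1 @[n --> \oo] --> sin (pi * x) / pi * 1^-1.
  apply: cvgM; first exact: cvg_cst.
  by apply: cvgV => //; rewrite oner_eq0.
rewrite invr1 mulr1 in h; apply: cvg_trans h; apply: near_eq_cvg; near=> n.
(* The ratio tends to 1, so it is eventually positive and can be cancelled. *)
rewrite -(sine_product_ratio R x n) mulfK//.
rewrite gt_eqF//; near: n; exact: (cvgr_gt 1 q1).
Unshelve. all: by end_near. Qed.

(** * The reflection formula *)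

(** Pairing shifted by one: x + i times 1 - x + (i - 1) = i - x gives i^2 (1 - x^2/i^2) for 1 <= i
    <= n. The factors x and 1 - x + n stay unpaired. *)
Lemma prod_reflection (R : realType) (x : R) (n : nat) :
  \prod_(i < n.+1) (x + i%:R) * \prod_(i < n.+1) (1 - x + i%:R) =
  n`!%:R ^+ 2 * (x * (\prod_(i < n) (1 - x ^+ 2 / i.+1%:R ^+ 2)) *
    (1 - x + n%:R)).
Proof.
elim: n => [|n IH].
  by rewrite !big_ord_recl !big_ord0 fact0 !addr0 !mulr1; ring.
rewrite big_ord_recr [X in _ * X]big_ord_recr [in RHS]big_ord_recr /= mulrACA IH.
rewrite factS natrM.
have n0 : n.+1%:R != 0 :> R by rewrite pnatr_eq0.
have -> : n%:R = n.+1%:R - 1 :> R by rewrite -natr1 addrK.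
move: (n.+1%:R : R) n0 => u u0.
by field.
Qed.

(** In the product of the two Euler sequences the factorials cancel and n^x n^(1 - x) = n, leaving
    the partial sine product times (1 - x + n)/n, which tends to 1. *)
Lemma rGamma_reflection (R : realType) (x : R) :
  rGamma x * rGamma (1 - x) = sin (pi * x) / pi.
Proof.
have h1 : rGamma_seq R x n * rGamma_seq R (1 - x) n @[n --> \oo] -->
    rGamma x * rGamma (1 - x).
  exact: cvgM (rGamma_seq_cvg R x) (rGamma_seq_cvg R (1 - x)).
have h2 : x * (\prod_(i < n) (1 - x ^+ 2 / i.+1%:R ^+ 2)) *
    ((1 - x + n%:R) / (0 + n%:R)) @[n --> \oo] --> sin (pi * x) / pi.
  by rewrite -[X in _ --> X]mulr1; exact: cvgM (sine_product R x) (cvg_ratio1 R (1 - x) 0).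
have h3 : rGamma_seq R x n * rGamma_seq R (1 - x) n @[n --> \oo] --> sin (pi * x) / pi.
  apply: cvg_trans h2; apply: near_eq_cvg; near=> n.
  have n0 : (0 < n)%N by near: n; exists 1%N.
  have nR : 0 < n%:R :> R by rewrite ltr0n.
  have fn0 : n`!%:R != 0 :> R by rewrite pnatr_eq0 -lt0n fact_gt0.
  have pw : n%:R `^ x * n%:R `^ (1 - x) = n%:R :> R.
    by rewrite -powRD ?(gt_eqF nR) ?implybT// subrKC powRr1 ?ler0n.
  rewrite add0r /rGamma_seq [RHS]mulrACA prod_reflection -invfM [X in _ = _ / X]mulrACA pw -expr2.
  by field; rewrite fn0 (gt_eqF nR).
by rewrite -(cvg_lim (@norm_hausdorff _ _) h1); exact: cvg_lim h3.
Unshelve. all: by end_near. Qed.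

(** * The numbers Z_l, 2 by 2 matrices and the powers of rho(T) *)

Lemma Z_cos_sin (R : realType) (k : rat) (l : int) :
  Z R k l = cos (2 * l%:~R * theta R k) +i* sin (2 * l%:~R * theta R k).
Proof.
have -> : Z R k l = expc (0 +i* (2 * l%:~R * theta R k)).
  rewrite /Z -complexiE; congr expc.
  have -> : (2 * l%:~R : R[i]) = (2 * l%:~R : R)%:C by rewrite rmorphM rmorph_nat rmorph_int.
  by apply/eqP; rewrite eq_complex /=; apply/andP; split; apply/eqP; ring.
by rewrite /expc /= expR0 mul1r.
Qed.

Lemma ZD (R : realType) (k : rat) (l m : int) :
  Z R k (l + m) = Z R k l * Z R k m.
Proof.
rewrite !Z_cos_sin.
have -> : 2 * (l + m)%:~R * theta R k =
    2 * l%:~R * theta R k + 2 * m%:~R * theta R k by rewrite intrD; ring.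
rewrite cosD sinD; apply/eqP; rewrite eq_complex /=.
by apply/andP; split; apply/eqP; ring.
Qed.

Lemma Z0 (R : realType) (k : rat) : Z R k 0 = 1.
Proof. by rewrite Z_cos_sin mulr0 mul0r cos0 sin0. Qed.

Lemma mx2M (A : pzRingType) (a b c d a' b' c' d' : A) :
  mx2 a b c d * mx2 a' b' c' d' =
  mx2 (a * a' + b * c') (a * b' + b * d') (c * a' + d * c') (c * b' + d * d').
Proof.
by apply/matrixP => -[[|[|//]] ?] [[|[|//]] ?];
  rewrite /mx2 !mxE !big_ord_recl big_ord0 !mxE /= addr0.
Qed.

Lemma mx2D (A : nmodType) (a b c d a' b' c' d' : A) :
  mx2 a b c d + mx2 a' b' c' d' = mx2 (a + a') (b + b') (c + c') (d + d').
Proof. by apply/matrixP => -[[|[|//]] ?] [[|[|//]] ?]; rewrite !mxE. Qed.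

Lemma mx2Z (A : pzRingType) (x a b c d : A) :
  x *: mx2 a b c d = mx2 (x * a) (x * b) (x * c) (x * d).
Proof. by apply/matrixP => -[[|[|//]] ?] [[|[|//]] ?]; rewrite !mxE. Qed.

Lemma mx2_scalar (A : pzRingType) (x : A) : x%:M = mx2 x 0 0 x.
Proof. by apply/matrixP => -[[|[|//]] ?] [[|[|//]] ?]; rewrite !mxE. Qed.

(** The matrices [f n] form a homomorphic image of the integers because Z_(m+n) = Z_m Z_n, and [f 1]
    is rho(T); this covers negative exponents too. *)
Lemma rhoT_exp (R : realType) (k : rat) (r : int) :
  rhoT R k ^ r =
  mx2 1 (4 * 'i * (G12 R k)%:C * (1 - Z R k r)) 0 (Z R k r).
Proof.
set b := 4 * 'i * _.
pose f (n : int) := mx2 1 (b * (1 - Z R k n)) 0 (Z R k n).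
have fM m n : f m * f n = f (m + n).
  by rewrite /f mx2M ZD; congr mx2; ring.
have f0 : f 0 = 1.
  by rewrite /f Z0 subrr mulr0 -mx2_scalar.
have fE (n : nat) : f 1 ^+ n = f n.
  by elim: n => [|n IH]; rewrite ?expr0 ?f0// exprSr IH fM -PoszD addn1.
have fN (n : int) : (f n)^-1 = f (- n).
  have fu : f n * f (- n) = 1 by rewrite fM subrr.
  have un : f n \is a GRing.unit.
    by apply/unitrP; exists (f (- n)); rewrite !fM addNr subrr.
  by rewrite -[LHS]mulr1 -fu mulKr.
by case: r => n; [exact: fE | rewrite NegzE -[LHS]/((f 1 ^+ n.+1)^-1) fE fN].
Qed.

(** * Nonvanishing of sin(theta) and the value of G12 G21 *)

Lemma sin_int_pi (R : realType) (m : int) : sin (m%:~R * pi) = 0 :> R.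
Proof.
have h (n : nat) : sin (n%:R * pi) = 0 :> R.
  elim: n => [|n IH]; first by rewrite mul0r sin0.
  by rewrite -natr1 mulrDl mul1r sinDpi IH oppr0.
by case: m => n; rewrite ?NegzE ?mulrNz ?mulNr ?sinN h ?oppr0.
Qed.

(** Otherwise the fractional part of q lies in (0, 1), where sin(pi t) is positive; subtracting the
    floor changes the sine only by a sign. *)
Lemma ratr_int_of_sin_eq0 (R : realType) (q : rat) :
  sin (ratr q * pi) = 0 :> R -> exists m : int, q = m%:~R.
Proof.
move=> h; exists (Num.floor q); apply/eqP; rewrite eq_sym eq_le floor_le /=.
rewrite leNgt; apply/negP => lt_q.
have pi_gt0 := pi_gt0 R.
have : 0 < sin ((ratr q - (Num.floor q)%:~R) * pi : R).
  apply: sin_gt0_pi; rewrite mulr_gt0 //=; last first.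
    by rewrite subr_gt0 -(ratr_int R) ltr_rat.
  rewrite -[ltRHS]mul1r ltr_pM2r// ltrBlDl.
  rewrite -[1]/(1%:~R) -intrD -(ratr_int R) ltr_rat.
  exact: floorD1_gt.
by rewrite mulrBl sinB h sin_int_pi mulr0 mul0r subrr ltxx.
Qed.

(** A zero forces k = 6m - 1 with m an integer, and the parity of m decides between the classes 11
    and 5. *)
Lemma sin_theta_neq0 (R : realType) (k : rat) :
  ~ congr12 k 5 -> ~ congr12 k 11 -> sin (theta R k) != 0.
Proof.
move=> h5 h11; apply/eqP => h0.
have /ratr_int_of_sin_eq0 [m hm] : sin (ratr ((1 + k) / 6) * pi) = 0 :> R.
  rewrite -[RHS]h0 /theta; congr (sin (_ * pi)).
  by rewrite rmorphM rmorphD rmorph1 fmorphV rmorph_nat.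
have hk : k = 6 * m%:~R - 1 by rewrite -hm; lra.
have := divz_eq m 2; have := modz_ge0 m (isT : 2 != 0 :> int).
have := ltz_pmod m (isT : 0 < 2 :> int).
case: (m %% 2)%Z => [[|[|//]]|//] _ _ hdiv.
(* For even m, k = 12(m/2) - 1 = 11 + 12(m/2 - 1). *)
- apply: h11; exists ((m %/ 2)%Z - 1).
  by rewrite hk {1}hdiv !(intrD, intrM, intrB, addr0); ring.
- apply: h5; exists (m %/ 2)%Z.
  by rewrite hk {1}hdiv !(intrD, intrM, intrB); ring.
Qed.

(** The triple angle formula at pi/3 reads (c + 1)(2c - 1)^2 = 0 for c = cos(pi/3), and c > 0. *)
Lemma cos_pi3 (R : realType) : cos (pi / 3) = 1 / 2 :> R.
Proof.
have pi_gt0 := pi_gt0 R.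
have c_gt0 : 0 < cos (pi / 3) :> R.
  by apply: cos_gt0_pihalf; apply/andP; split; lra.
have := cosD (pi / 3 + pi / 3) (pi / 3 : R).
have -> : pi / 3 + pi / 3 + pi / 3 = pi :> R by field.
rewrite cospi sinD cosD => h.
have s2 : sin (pi / 3) * sin (pi / 3) * cos (pi / 3) =
    (1 - cos (pi / 3) * cos (pi / 3)) * cos (pi / 3) :> R.
  by rewrite -!expr2 sin2cos2.
have {h s2} : (cos (pi / 3) + 1) * (2 * cos (pi / 3) - 1 : R) ^+ 2 = 0 by lra.
move/eqP; rewrite mulf_eq0 expf_eq0 /= => /orP[/eqP|/eqP]; lra.
Qed.

(** At sin(theta) = 0 the convention 1/0 = 0 would give 0 on the left and 1/16 on the right. *)
Lemma G12_mul_G21 (R : realType) (k : rat) : sin (theta R k) != 0 ->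
  G12 R k * G21 R k = 1 / 16 + cosec R k / 32.
Proof.
move=> sn0.
have pi0 : (pi : R) != 0 by rewrite gt_eqF ?pi_gt0.
pose q : R := ratr k.
have H1 := rGamma_reflection R ((1 + q) / 6).
have H2 := rGamma_reflection R ((2 + q) / 12).
have H3 := rGamma_reflection R ((6 + q) / 12).
have e1 : 1 - (1 + q) / 6 = (5 - q) / 6 by field.
have e2 : 1 - (2 + q) / 12 = (10 - q) / 12 by field.
have e3 : 1 - (6 + q) / 12 = (6 - q) / 12 by field.
rewrite e1 in H1; rewrite e2 in H2; rewrite e3 in H3.
have eth : pi * ((1 + q) / 6) = theta R k by rewrite /theta mulrC.
rewrite eth in H1.
have trig : sin (pi * ((2 + q) / 12)) * sin (pi * ((6 + q) / 12)) =
    (1 / 2 + sin (theta R k)) / 2.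
  set x := pi * _; set y := pi * _.
  (* y - x = pi / 3 and x + y = theta + pi / 2 *)
  have -> : sin x * sin y = (cos (y - x) - cos (x + y)) / 2.
    by rewrite cosB cosD; field.
  have -> : x + y = theta R k + pi / 2 by rewrite /theta /x /y -/q; field.
  have -> : y - x = pi / 3 by rewrite /x /y; field.
  by rewrite cosDpihalf opprK cos_pi3.
have sq : Num.sqrt pi * Num.sqrt pi = pi :> R by rewrite -expr2 sqr_sqrtr// ltW// pi_gt0.
have P1 : Gamma ((1 + q) / 6) * Gamma ((5 - q) / 6) = pi / sin (theta R k).
  by rewrite /Gamma -invfM H1 invf_div.
rewrite /G12 /G21 -/q.
set a := Num.sqrt pi in sq *.
transitivity ((a * a) * (Gamma ((1 + q) / 6) * Gamma ((5 - q) / 6)) / 8 *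
  ((rGamma ((2 + q) / 12) * rGamma ((10 - q) / 12)) *
   (rGamma ((6 + q) / 12) * rGamma ((6 - q) / 12)))).
  by field.
rewrite sq P1 H2 H3 /cosec.
move: trig sn0 pi0; move: (sin (pi * ((2 + q) / 12))) (sin (pi * ((6 + q) / 12))).
move: (sin (theta R k)) (pi : R) => t p u v uv t0 p0.
(* All powers of pi cancel: sqrt(pi)^2 and the Gamma pair give pi^2, the two reciprocal pairs give u
   v/pi^2. *)
transitivity ((u * v) / t / 8); first by field; rewrite t0 p0.
by rewrite uv; field.
Qed.

(** * The closed formula for N(r,s) *)

Theorem theorem4p4 (R : realType) (k : rat)
  (hk0 : ~ congr12 k 0) (hk4 : ~ congr12 k 4)
  (hk5 : ~ congr12 k 5) (hk11 : ~ congr12 k 11)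
  (r s : int) (hr : r <> 1) (hs : s <> 1) :
  N R k r s = (rhoT R k ^ r * rhoS R k * rhoT R k ^ s * rhoS R k) ^+ 2 /\
  N R k r s =
    (- (Z R k r * Z R k s))%:M +
    (1 / 2 * K R k r s) *:
      mx2
        (1 / 2 + 1 / 8 * (2 * (Z R k s - 1) + W R k s) * (2 + W R k r))
        ('i * (G12 R k)%:C *
           (2 * (Z R k s - Z R k r) + (Z R k r - 1) * W R k s))
        ('i * (G21 R k)%:C * Z R k r * W R k s)
        (1 / 4 * Z R k r * (2 - W R k s)).
Proof.
have NE : N R k r s =
    (rhoT R k ^ r * rhoS R k * rhoT R k ^ s * rhoS R k) ^+ 2.
  by rewrite /N /rho /TrSTsS /= !big_cons big_nil /= !expr1z mulr1 expr2 !mulrA.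
split=> //; rewrite {}NE.
have hG := G12_mul_G21 R k (sin_theta_neq0 R k hk5 hk11).
have {}hG : (G12 R k)%:C * (G21 R k)%:C = 1 / 16 + (cosec R k)%:C / 32 :> R[i].
  by rewrite -rmorphM hG rmorphD !rmorphM !fmorphV !rmorph_nat.
(* The square is multiplied out entry by entry. *)
rewrite !rhoT_exp /rhoS /K /W mx2_scalar expr2 !mx2M mx2Z mx2D.
have i2 : 'i * 'i = -1 :> R[i] by rewrite -expr2 sqrCi.
move: hG i2; move: (Z R k r) (Z R k s) (G12 R k)%:C (G21 R k)%:C (cosec R k)%:C.
move: ('i : R[i]) => i zr zs g h c hG i2.
(* The off-diagonal coefficients of rho(T)^r and rho(S), up to sign and the factor 1 - Z_r. Both
   remaining relations enter only through a d = -(1 + C/2); eliminating C by it leaves identities in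
   Z_r, Z_s, a and d. *)
set a := 4 * i * g; set d := 4 * i * h.
have had : a * d = - (1 + c / 2).
  transitivity (16 * (i * i) * (g * h)); first by rewrite /a /d; ring.
  by rewrite hG i2; field.
have -> : i * g = a / 4 by rewrite /a; field.
have -> : i * h = d / 4 by rewrite /d; field.
have -> : c = - 2 * (a * d) - 2 by rewrite had; field.
by congr mx2; field.
Qed.
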